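(* If $\mathfrak{s}\ge1/2$, then (for every $N$) the harmonic model with spin $\mathfrak{s}$, i.e. the Markov process on $\mathbb{N}_0^{\mathbb{T}_N}$ with generator $L_N^{\mathrm{Harm}}=\sum_{x\in\mathbb{T}_N}\big(\nabla_{x,x+1}^{\mathrm{Harm}}+\nabla_{x+1,x}^{\mathrm{Harm}}\big)$, where $$\nabla_{x,y}^{\mathrm{Harm}}f(\eta)=\sum_{k=1}^{\eta_x}\frac{\Gamma(\eta_x+1)\Gamma(\eta_x-k+2\mathfrak{s})}{k\,\Gamma(\eta_x-k+1)\Gamma(\eta_x+2\mathfrak{s})}\big[f(\eta-k\delta_x+k\delta_y)-f(\eta)\big],$$ is attractive.
   Context: $\mathbb{N}_0=\{0,1,\dots\}$; for an integer $N\ge2$, $\mathbb{T}_N=\mathbb{Z}/N\mathbb{Z}\cong\{0,\dots,N-1\}$ is the discrete torus. $\Gamma$ is the Gamma function and $\delta_x$ is the configuration with exactly one particle, located at $x$. A function $f$ on the configuration space is monotone if $f(\eta)\le f(\xi)$ whenever $\eta_x\le\xi_x$ for all $x\in\mathbb{T}_N$. For probability measures $\mu_1,\mu_2$ on the configuration space, $\mu_1\le\mu_2$ means $E_{\mu_1}[f]\le E_{\mu_2}[f]$ for every bounded monotone $f$. A process with Markov semigroup $\{S(t):t\ge0\}$ is called attractive if for all probability measures $\mu_1\le\mu_2$ on the configuration space one has $S(t)\mu_1\le S(t)\mu_2$ for all $t\ge0$, where $S(t)\mu$ denotes the law at time $t$ of the process started from $\mu$. *)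

(* Defs.v *)
From HB Require Import structures.
From mathcomp Require Import all_boot all_order all_algebra.
From mathcomp Require Import all_classical all_reals all_analysis.

Set Implicit Arguments.
Unset Strict Implicit.
Unset Printing Implicit Defensive.

Import Order.TTheory GRing.Theory Num.Theory.
Import numFieldNormedType.Exports.

Local Open Scope classical_set_scope.
Local Open Scope ring_scope.

(* 'Z_N is Z/NZ only for N >= 2; statements must assume it. *)
Definition config (N : nat) : Type := {ffun 'Z_N -> nat}.

HB.instance Definition _ (N : nat) := Countable.on (config N).
HB.instance Definition _ (N : nat) :=
  isPointed.Build (config N) [ffun=> 0%N].
HB.instance Definition _ (N : nat) :=
  @isMeasurable.Build default_measure_display (config N)
    discrete_measurable discrete_measurable0
    discrete_measurableC discrete_measurableU.

Section law_after_kernel.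
Context d d' (X : measurableType d) (Y : measurableType d') (R : realType).
Variables (k : R.-pker X ~> Y) (mu : probability X R).
Local Open Scope ereal_scope.

(* The law of the second coordinate when the first has law mu and the second is
   drawn from the kernel k. *)
Definition push_kernel (A : set Y) : \bar R := \int[mu]_x k x A.

Let push_kernel0 : push_kernel set0 = 0.
Proof. by apply: integral0_eq => x _; rewrite measure0. Qed.

Let push_kernel_ge0 A : 0 <= push_kernel A.
Proof. by apply: integral_ge0 => x _; exact: measure_ge0. Qed.

Let push_kernel_sigma_additive : semi_sigma_additive push_kernel.
Proof.
move=> F mF tF mUF; rewrite [X in _ --> X](_ : _ =
    \int[mu]_x \sum_(n <oo) k x (F n)); last first.
  by apply: eq_integral => x _; apply/esym/cvg_lim => //;
    exact: measure_semi_sigma_additive.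
rewrite integral_nneseries//; last by move=> n; exact: measurable_kernel.
rewrite /push_kernel; apply: is_cvg_nneseries => n _ _.
by apply: integral_ge0.
Qed.

HB.instance Definition _ := isMeasure.Build _ _ _ push_kernel
  push_kernel0 push_kernel_ge0 push_kernel_sigma_additive.

Let push_kernel_setT : push_kernel setT = 1.
Proof.
rewrite /push_kernel (eq_integral (cst 1)); last first.
  by move=> x _; exact: prob_kernel.
by rewrite integral_cst// mul1e; exact: probability_setT.
Qed.

HB.instance Definition _ :=
  Measure_isProbability.Build _ _ _ push_kernel push_kernel_setT.

End law_after_kernel.

Section markov_semigroup.
Context d (T : measurableType d) (R : realType).
Implicit Types (S : R -> R.-pker T ~> T) (L : (T -> R) -> T -> R).

(* S t x A is the probability of being in A at time t when started from x; only
   the times t >= 0 are meaningful. *)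
Record markov_semigroup S : Prop := {
  semigroup0 : forall x A, measurable A -> S 0 x A = \d_x A ;
  semigroupD : forall s t x A, 0 <= s -> 0 <= t -> measurable A ->
    S (s + t) x A = (\int[S s x]_y S t y A)%E }.

(* The action (S(t) f)(x) = E_x[f(eta_t)] on functions. *)
Definition semigroup_fun S (t : R) (f : T -> R) (x : T) : R :=
  \int[S t x]_y f y.

(* The limit is pointwise, not uniform: the jump rates, hence L f, may be
   unbounded on T even for bounded f. *)
Definition has_generator S L : Prop :=
  forall f : T -> R, measurable_fun setT f -> bounded_fun f ->
  forall x, h^-1 * (semigroup_fun S h f x - f x) @[h --> 0^'+] --> L f x.

End markov_semigroup.

Section attractiveness.
Context (R : realType) (N : nat).

Definition monotone_fun (f : config N -> R) : Prop :=
  forall eta xi : config N, (forall x, (eta x <= xi x)%N) -> f eta <= f xi.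

Definition stoch_le (mu1 mu2 : probability (config N) R) : Prop :=
  forall f : config N -> R, bounded_fun f -> monotone_fun f ->
  ('E_mu1[f] <= 'E_mu2[f])%E.

Definition attractive (S : R -> R.-pker config N ~> config N) : Prop :=
  forall mu1 mu2 : probability (config N) R, stoch_le mu1 mu2 ->
  forall t : R, 0 <= t ->
  stoch_le (push_kernel (S t) mu1) (push_kernel (S t) mu2).

End attractiveness.

Section harmonic_model.
Context (R : realType).

(* Euler's integral; meaningful for z > 0. *)
Definition Gamma (z : R) : R :=
  \int[lebesgue_measure]_(t in `]0, +oo[) (t `^ (z - 1) * expR (- t)).

Definition harm_rate (s : R) (n k : nat) : R :=
  (Gamma (n%:R + 1) * Gamma (n%:R - k%:R + 2 * s)) /
  (k%:R * Gamma (n%:R - k%:R + 1) * Gamma (n%:R + 2 * s)).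

(* eta - k delta_x + k delta_y, used with k <= eta x and x != y, so that the
   truncated subtraction is exact. *)
Definition move_particles (N : nat) (x y : 'Z_N) (k : nat) (eta : config N) :
    config N :=
  [ffun z => (eta z - k * (z == x) + k * (z == y))%N].

Definition nabla_harm (N : nat) (s : R) (x y : 'Z_N) (f : config N -> R)
    (eta : config N) : R :=
  \sum_(1 <= k < (eta x).+1)
    harm_rate s (eta x) k * (f (move_particles x y k eta) - f eta).

Definition gen_harm (N : nat) (s : R) (f : config N -> R) (eta : config N) :
    R :=
  \sum_(x : 'Z_N) (nabla_harm s x (x + 1) f eta + nabla_harm s (x + 1) x f eta).

End harmonic_model.

(* Main.v *)
From HB Require Import structures.
Require Import Defs.
From mathcomp Require Import all_boot all_order all_algebra.
From mathcomp Require Import all_classical all_reals all_analysis.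
From mathcomp Require Import measurable_realfun zify ring lra.

Set Implicit Arguments.
Unset Strict Implicit.
Unset Printing Implicit Defensive.

Import Order.TTheory GRing.Theory Num.Theory.
Import numFieldNormedType.Exports.

Local Open Scope classical_set_scope.
Local Open Scope ring_scope.

(** Attractiveness means that P_t f is monotone whenever f is bounded and
    monotone, where P_t f (eta) = E_eta [f (eta_t)]: the laws at time t are then
    compared by integrating P_t f against the initial laws. A function is
    monotone as soon as no increment g (eta + delta_z) - g eta is negative, so
    only pairs of configurations that differ by one particle have to be compared.

    Write a_k and b_k for the rates at which k particles leave a site occupied by
    n + 1, respectively n, particles. The functional equation of the Gamma
    function gives
      b_k / a_k = (n - k + 1) (n + 2 s) / ((n + 1) (n - k + 2 s)),
      a_(k+1) / b_k = k (n + 1) / ((k + 1) (n + 2 s)),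
    and for 2 s >= 1 both are at most 1. Hence the rates interlace:
      a_1 >= b_1 >= a_2 >= b_2 >= ... >= b_n >= a_(n+1).
    This makes it possible to couple a jump of l particles in the smaller system
    with a jump of l or l + 1 particles in the larger one, so that after any
    coupled jump the two systems still differ by one particle, which either stayed
    or moved along. The lemma [interlaced_sum_ge0] is that coupling in summed
    form. Applied bond by bond ([nabla_harm_increment], [gen_harm_increment]) it
    bounds the increments of L g from below by those of g. Consequently an Euler
    step g |-> g + h L g with h times the exit rate at most 1 preserves every
    lower bound that the increments of g have on the configurations with a given
    number of particles ([euler_step_increment]).

    It remains to compare P_h with the Euler step. Jumps preserve the number of
    particles, and only finitely many configurations have a given number n of
    them. On that level a bounded g is therefore a finite combination of
    indicators of points, and the rest of g contributes to P_h g at most its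
    bound times the probability of leaving the level. The generator evaluated on
    these finitely many indicators gives |P_h g - (g + h L g)| <= eps h on the
    level for all small h, simultaneously for all g with a common bound
    ([euler_error_uniform]). Writing P_t as the j-th iterate of P_(t/j) then
    costs at most eps in total, and eps is arbitrary
    ([semigroup_increment_ge0]). *)

(** * The Gamma function on [1, +oo[ *)

Section gamma_function.
Context (R : realType).
Implicit Types z t : R.
Local Notation mu := (@lebesgue_measure R).

Definition gamma_density z t : R := t `^ (z - 1) * expR (- t).

(** The extended-real version of Euler's integral: sums of integrals of
    nonnegative functions can be rearranged before finiteness is known. *)
Definition eGamma z : \bar R :=
  (\int[mu]_(t in `]0%R, +oo[) (gamma_density z t)%:E)%E.

Lemma gamma_density_ge0 z t : 0 <= gamma_density z t.
Proof. by rewrite mulr_ge0 ?powR_ge0 ?expR_ge0. Qed.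

Lemma measurable_gamma_density z (D : set R) :
  measurable_fun D (gamma_density z).
Proof.
apply/measurable_funTS/measurable_funM => //.
exact: measurableT_comp.
Qed.

Lemma measurable_EFin_gamma_density z (D : set R) :
  measurable_fun D (EFin \o gamma_density z).
Proof. by apply/measurable_EFinP; exact: measurable_gamma_density. Qed.

Lemma cvg_powR_expRN z : t `^ z * expR (- t) @[t --> +oo] --> (0 : R).
Proof.
have [n zn] : exists n : nat, z <= n%:R.
  by exists (Num.truncn `|z|).+1; rewrite (le_trans (ler_norm _))// ltW// truncnS_gt.
apply/cvgrPdist_le => e e0; near=> t.
have t1 : 1 <= t by near: t; apply: nbhs_pinfty_ge; exact: num_real.
have t0 : 0 < t by rewrite (lt_le_trans ltr01).
rewrite sub0r normrN ger0_norm ?mulr_ge0 ?powR_ge0 ?expR_ge0//.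
have f0 : 0 < (n.+1`!)%:R :> R by rewrite ltr0n fact_gt0.
have le1 : t `^ z * expR (- t) <= t ^+ n * (t ^+ n.+1 / n.+1`!%:R)^-1.
  apply: ler_pM; rewrite ?powR_ge0 ?expR_ge0//.
    by rewrite -powR_mulrn ?(ltW t0)// ler_powR.
  rewrite expRN lef_pV2 ?posrE ?expR_gt0 ?divr_gt0 ?exprn_gt0//.
  by apply: le_trans (expR_ge1Dxn n (ltW t0)); rewrite lerDr.
apply: (le_trans le1).
rewrite invf_div exprSr.
have -> : t ^+ n * (n.+1`!%:R / (t ^+ n * t)) = n.+1`!%:R / t.
  by field; rewrite gt_eqF//= expf_neq0// gt_eqF.
rewrite ler_pdivrMr// -ler_pdivrMl// mulrC.
Unshelve. all: by end_near. Qed.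

Lemma cvg_powR_at0 z : 0 <= z -> t `^ z @[t --> 0^'+] --> (0 : R) `^ z.
Proof.
rewrite le_eqVlt => /predU1P[<-|z0].
  rewrite powRr0; under eq_fun do rewrite powRr0; exact: cvg_cst.
by rewrite powR0 ?gt_eqF//; exact: powR_cvg0.
Qed.

Lemma within_continuous_powR z : 0 <= z ->
  {within `[0%R, +oo[, continuous (fun t => t `^ z)}.
Proof.
move=> z0; apply/continuous_within_itvcyP; split; last exact: cvg_powR_at0.
move=> x; rewrite in_itv/= andbT => x0.
apply: differentiable_continuous; apply/derivable1_diffP.
by apply: ex_derive; exact: is_derive1_powR.
Qed.

(** The derivative of - (t^z + C) e^-t. Without the constant C it would change
    sign; any C >= z^z compensates the negative part, because z t^(z-1) <= t^z when
    t >= z and z t^(z-1) <= z^z otherwise. *)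
Lemma gamma_shift_ge0 z (C x : R) : 1 <= z -> z `^ z <= C -> 0 <= x ->
  0 <= (x `^ z + C - z * x `^ (z - 1)) * expR (- x).
Proof.
move=> z1 zC x0; have z0 : 0 < z by rewrite (lt_le_trans ltr01).
have zm0 : 0 <= z - 1 by rewrite subr_ge0.
rewrite mulr_ge0 ?expR_ge0// subr_ge0.
have [xz|zx] := leP x z.
  rewrite (@le_trans _ _ C)// ?lerDr ?powR_ge0//.
  apply: le_trans zC.
  rewrite -(@mulr_powRB1 _ z z) ?(ltW z0)//.
  rewrite ler_wpM2l ?(ltW z0)//.
  by apply: ge0_ler_powR; rewrite // nnegrE ltW.
rewrite (@le_trans _ _ (x `^ z))// ?lerDl; last first.
  by apply: le_trans zC; exact: powR_ge0.
rewrite -(@mulr_powRB1 _ x z)//.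
by rewrite ler_wpM2r ?powR_ge0// ltW.
Qed.

(** Integration by parts for the Gamma integral, arranged so that the integrand
    is nonnegative, as the fundamental theorem of calculus on the half-line
    requires. *)
Lemma integral_gamma_shift z (C : R) : 1 <= z -> z `^ z <= C ->
  (\int[mu]_(t in `]0%R, +oo[)
     ((t `^ z + C - z * t `^ (z - 1)) * expR (- t))%:E = C%:E)%E.
Proof.
move=> z1 zC; have z0 : 0 < z by rewrite (lt_le_trans ltr01).
have zm0 : 0 <= z - 1 by rewrite subr_ge0.
rewrite integral_itv_obnd_cbnd; last first.
  apply/measurable_EFinP/measurable_funTS/measurable_funM; last exact: measurableT_comp.
  apply: measurable_funB; first exact: measurable_funD.
  exact: measurable_funM.
have dE (x : R) : 0 < x -> is_derive x 1 (fun t : R => - ((t `^ z + C) * expR (- t)))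
     ((x `^ z + C - z * x `^ (z - 1)) * expR (- x)).
  move=> x0.
  have ? := is_derive1_powR z x0.
  apply: is_derive_eq.
  rewrite /GRing.scale/=; ring.
rewrite (@ge0_continuous_FTC2y _ _ (fun t => - ((t `^ z + C) * expR (- t))) _ 0)//.
- by rewrite powR0 ?gt_eqF// oppr0 expR0 add0r mulr1 add0r EFinN oppeK.
- by move=> x; exact: gamma_shift_ge0.
- apply/subspace_continuousP => x x0; apply: cvgM.
    apply: cvgB; last apply: cvgM.
    + apply: cvgD; last exact: cvg_cst.
      by move: x x0; apply/subspace_continuousP/within_continuous_powR/ltW.
    + exact: cvg_cst.
    + by move: x x0; apply/subspace_continuousP/within_continuous_powR.
  move: x x0; apply/subspace_continuousP; apply: continuous_subspaceT => x.
  by apply: continuous_comp; [exact: opp_continuous|exact: continuous_expR].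
- rewrite -oppr0; apply: cvgN.
  have h : t `^ z * expR (- t) + C * expR (- t) @[t --> +oo] --> (0 : R).
    rewrite -[X in _ --> X](_ : 0 + C * 0 = 0); last by rewrite mulr0 addr0.
    apply: cvgD; first exact: cvg_powR_expRN.
    by apply: cvgM; [exact: cvg_cst|exact: cvgr_expR].
  by under eq_fun do rewrite mulrDl.
- by move=> x /dE dx; apply: ex_derive.
- apply: cvgN; apply: cvgM.
    by apply: cvgD; [exact/cvg_powR_at0/ltW|exact: cvg_cst].
  apply: cvg_at_right_filter.
  by apply: continuous_comp; [exact: opp_continuous|exact: continuous_expR].
- move=> x; rewrite in_itv/= andbT => /dE dx.
  by rewrite derive1E; exact: derive_val.
Qed.

Lemma eGamma_ge0 z : (0 <= eGamma z)%E.
Proof. by apply: integral_ge0 => t _; rewrite lee_fin gamma_density_ge0. Qed.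

Lemma eGamma1 : eGamma 1 = 1%E.
Proof.
rewrite /eGamma integral_itv_obnd_cbnd; last exact: measurable_EFin_gamma_density.
have -> : 1%E = ((0 : R)%:E - (- expR (- 0))%:E)%E.
  by rewrite oppr0 expR0 EFinN oppeK add0e.
have cE : continuous (fun t : R => expR (- t)).
  move=> x; apply: continuous_comp; [exact: opp_continuous|exact: continuous_expR].
have e1 (x : R) : gamma_density 1 x = expR (- x).
  by rewrite /gamma_density subrr powRr0 mul1r.
have dE (x : R) : is_derive x 1 (fun t : R => - expR (- t)) (expR (- x)).
  apply: is_derive_eq; rewrite /GRing.scale/=; ring.
under eq_integral do rewrite e1.
apply: (@ge0_continuous_FTC2y _ _ (fun t => - expR (- t))).
- by move=> x _; exact: expR_ge0.
- exact: continuous_subspaceT.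
- by rewrite -[X in _ --> X]oppr0; apply: cvgN; exact: cvgr_expR.
- by move=> x _; have dx := dE x; exact: ex_derive.
- by apply: cvgN; apply: cvg_at_right_filter; exact: cE.
- by move=> x _; have dx := dE x; rewrite derive1E; exact: derive_val.
Qed.

Lemma eGammaZ c z : 0 <= c ->
  (\int[mu]_(t in `]0%R, +oo[) (c * gamma_density z t)%:E = c%:E * eGamma z)%E.
Proof.
move=> c0; under eq_integral do rewrite EFinM.
rewrite ge0_integralZl//; first exact: measurable_EFin_gamma_density.
by move=> t _; rewrite lee_fin gamma_density_ge0.
Qed.

Lemma eGammaS z : 1 <= z -> eGamma (z + 1) = (z%:E * eGamma z)%E.
Proof.
move=> z1; have z0 : 0 <= z by rewrite (le_trans ler01).
pose C := z `^ z.
have C0 : 0 <= C by exact: powR_ge0.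
pose r t := (t `^ z + C - z * t `^ (z - 1)) * expR (- t).
have rE := integral_gamma_shift z1 (lexx C).
have r0 t : `]0%R, +oo[%classic t -> 0 <= r t.
  by rewrite /= in_itv/= andbT => /ltW t0; exact: gamma_shift_ge0.
have mr : measurable_fun (`]0%R, +oo[ : set R) (fun t => (r t)%:E).
  apply/measurable_EFinP/measurable_funTS/measurable_funM; last exact: measurableT_comp.
  apply: measurable_funB; first exact: measurable_funD.
  exact: measurable_funM.
have mg c w : measurable_fun (`]0%R, +oo[ : set R)
    (fun t => (c * gamma_density w t)%:E).
  by apply/measurable_EFinP/measurable_funM => //; exact: measurable_gamma_density.
have e1 : (\int[mu]_(t in `]0%R, +oo[) ((r t)%:E + (z * gamma_density z t)%:E) =
    C%:E + z%:E * eGamma z)%E.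
  rewrite -rE -(eGammaZ _ z0); apply: ge0_integralD => //.
  - by move=> t _; rewrite lee_fin mulr_ge0 ?gamma_density_ge0.
  - exact: mg.
have e2 : (\int[mu]_(t in `]0%R, +oo[)
      ((gamma_density (z + 1) t)%:E + (C * gamma_density 1 t)%:E) =
    eGamma (z + 1) + C%:E * eGamma 1)%E.
  rewrite -(eGammaZ _ C0); apply: ge0_integralD => //.
  - by move=> t _; rewrite lee_fin gamma_density_ge0.
  - exact: measurable_EFin_gamma_density.
  - by move=> t _; rewrite lee_fin mulr_ge0 ?gamma_density_ge0.
  - exact: mg.
have : (C%:E + z%:E * eGamma z = eGamma (z + 1) + C%:E * eGamma 1)%E.
  rewrite -e1 -e2; apply: eq_integral => t; rewrite inE/= in_itv/= andbT => t0.
  rewrite -!EFinD; congr EFin.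
  rewrite /r /gamma_density addrK subrr powRr0; ring.
rewrite eGamma1 mule1 addeC => /(congr1 (fun x => x - C%:E)%E).
by rewrite !addeK// => ->.
Qed.

(** On t > 0 the density is dominated by the sum of those at 1 and at an integer
    n + 1 >= z, and the functional equation makes the latter finite. *)
Lemma eGamma_fin_num z : 1 <= z -> eGamma z \is a fin_num.
Proof.
move=> z1.
have natfin n : eGamma n.+1%:R \is a fin_num.
  elim: n => [|n ih]; first by rewrite eGamma1.
  by rewrite -natr1 eGammaS ?ler1n// fin_numM.
have [n zn] : exists n : nat, z <= n.+1%:R.
  by exists (Num.truncn `|z|); rewrite (le_trans (ler_norm _))// ltW// truncnS_gt.
rewrite ge0_fin_numE ?eGamma_ge0//.
apply: (@le_lt_trans _ _ (eGamma 1 + eGamma n.+1%:R)%E); last first.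
  by rewrite eGamma1 lte_add_pinfty ?ltry// -ge0_fin_numE ?eGamma_ge0 ?(natfin n).
have <- : (\int[mu]_(t in `]0%R, +oo[)
      ((gamma_density 1 t)%:E + (gamma_density n.+1%:R t)%:E) =
    eGamma 1 + eGamma n.+1%:R)%E.
  apply: ge0_integralD => //.
  - by move=> t _; rewrite lee_fin gamma_density_ge0.
  - exact: measurable_EFin_gamma_density.
  - by move=> t _; rewrite lee_fin gamma_density_ge0.
  - exact: measurable_EFin_gamma_density.
apply: ge0_le_integral => //.
- by move=> t _; rewrite lee_fin gamma_density_ge0.
- exact: measurable_EFin_gamma_density.
- by apply: emeasurable_funD; exact: measurable_EFin_gamma_density.
move=> t; rewrite /= in_itv/= andbT => t0.
rewrite -EFinD lee_fin /gamma_density -mulrDl ler_wpM2r ?expR_ge0//.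
rewrite subrr powRr0; have [t1|/ltW t1] := leP t 1.
  rewrite (@le_trans _ _ 1)// ?lerDl ?powR_ge0//.
  have := @ger_powR _ t; rewrite t0 t1 => /(_ isT 0 (z - 1)).
  by rewrite subr_ge0 powRr0; apply.
by rewrite (@le_trans _ _ (t `^ (n.+1%:R - 1)))// ?lerDr// ler_powR// lerB.
Qed.

Lemma GammaE z : Gamma z = fine (eGamma z).
Proof. by []. Qed.

Lemma GammaS z : 1 <= z -> Gamma (z + 1) = z * Gamma z.
Proof. by move=> z1; rewrite !GammaE eGammaS// fineM// eGamma_fin_num. Qed.

Lemma Gamma_gt0 z : 1 <= z -> 0 < Gamma z.
Proof.
move=> z1; rewrite GammaE fine_gt0// -ge0_fin_numE ?eGamma_ge0//.
rewrite eGamma_fin_num// andbT.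
(* on [1, 2] the density is at least e^-2 *)
apply: (@lt_le_trans _ _ (\int[mu]_(t in `[1%R, 2%R]) (cst (expR (- 2))%:E) t)%E).
  rewrite integral_cst//= lebesgue_measure_itv/= lte_fin ltr1n -EFinB -EFinM lte_fin.
  by rewrite mulr_gt0 ?expR_gt0// subr_gt0 ltr1n.
apply: (@le_trans _ _ (\int[mu]_(t in `[1%R, 2%R]) (gamma_density z t)%:E)%E).
  apply: ge0_le_integral => //.
  - by move=> t _; rewrite lee_fin expR_ge0.
  - exact: measurable_EFin_gamma_density.
  move=> t; rewrite /= in_itv/= => /andP[t1 t2]; rewrite lee_fin.
  rewrite -[leLHS]mul1r ler_pM ?expR_ge0//; last by rewrite ler_expR lerN2.
  by rewrite -[leLHS](powRr0 t) ler_powR// subr_ge0.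
apply: ge0_subset_integral => //.
- exact: measurable_EFin_gamma_density.
- by move=> t _; rewrite lee_fin gamma_density_ge0.
- move=> t; rewrite /= !in_itv/= andbT => /andP[t1 _]; exact: lt_le_trans t1.
Qed.


End gamma_function.

(** * Interlacing of the jump rates *)

Section harmonic_rates.
Context (R : realType) (s : R).
Hypothesis hs : 1 / 2 <= s.

Let s2_ge1 : 1 <= 2 * s.
Proof. by move: hs; lra. Qed.

Let natrD_ge1 (n : nat) : 1 <= n%:R + 2 * s.
Proof. by rewrite (le_trans s2_ge1)// lerDr. Qed.

Let natr1_ge1 (n : nat) : 1 <= n%:R + 1 :> R.
Proof. by rewrite lerDr. Qed.

Lemma harm_rate_gt0 n k : (0 < k)%N -> (k <= n)%N -> 0 < harm_rate s n k.
Proof.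
move=> k0 kn; have := @GammaS R; have := @Gamma_gt0 R; rewrite /harm_rate.
move: (@Gamma R) => G G_gt0 GS; rewrite -natrB//.
by rewrite divr_gt0 ?mulr_gt0 ?G_gt0 ?ltr0n.
Qed.

Lemma harm_rateS n k : (k <= n)%N ->
  harm_rate s n.+1 k =
  harm_rate s n k * ((n%:R + 1) * ((n - k)%:R + 2 * s) /
                     (((n - k)%:R + 1) * (n%:R + 2 * s))).
Proof.
move=> kn; have := @GammaS R; have := @Gamma_gt0 R; rewrite /harm_rate.
move: (@Gamma R) => G G_gt0 GS; rewrite -!natrB// 1?leqW// subSn//.
have g1 : G (n.+1%:R + 1) = (n%:R + 1) * G (n%:R + 1) :> R.
  by rewrite -natr1 GS.
have g2 : G ((n - k).+1%:R + 2 * s) =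
    ((n - k)%:R + 2 * s) * G ((n - k)%:R + 2 * s).
  by rewrite -GS// -natr1 addrAC.
have g3 : G ((n - k).+1%:R + 1) = ((n - k)%:R + 1) * G ((n - k)%:R + 1) :> R.
  by rewrite -natr1 GS.
have g4 : G (n.+1%:R + 2 * s) = (n%:R + 2 * s) * G (n%:R + 2 * s).
  by rewrite -GS// -natr1 addrAC.
rewrite g1 g2 g3 g4 !invfM.
by ring.
Qed.

Lemma harm_rateSS n k : (0 < k)%N -> (k <= n)%N ->
  harm_rate s n.+1 k.+1 =
  harm_rate s n k * ((k%:R / k.+1%:R) * ((n%:R + 1) / (n%:R + 2 * s))).
Proof.
move=> k0 kn; have := @GammaS R; have := @Gamma_gt0 R; rewrite /harm_rate.
move: (@Gamma R) => G G_gt0 GS; rewrite -!natrB// subSS.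
have g1 : G (n.+1%:R + 1) = (n%:R + 1) * G (n%:R + 1) :> R.
  by rewrite -natr1 GS.
have g4 : G (n.+1%:R + 2 * s) = (n%:R + 2 * s) * G (n%:R + 2 * s).
  by rewrite -GS// -natr1 addrAC.
rewrite g1 g4 !invfM.
have kk : k%:R * k%:R^-1 = 1 :> R by rewrite divff// pnatr_eq0 -lt0n.
rewrite -[LHS]mulr1 -[X in _ * X = _]kk; ring.
Qed.

(** The ratio in [harm_rateS] is at least 1 because
    (n + 1) (m + 2 s) - (m + 1) (n + 2 s) = (n - m) (2 s - 1) with m = n - k. *)
Lemma harm_rate_monoS n k : (0 < k)%N -> (k <= n)%N ->
  harm_rate s n k <= harm_rate s n.+1 k.
Proof.
move=> k0 kn; rewrite harm_rateS// ler_peMr ?(ltW (harm_rate_gt0 k0 kn))//.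
have mn : (n - k)%:R <= n%:R :> R by rewrite ler_nat leq_subr.
have := natrD_ge1 n; have := natr1_ge1 (n - k) => p1 p2.
rewrite ler_pdivlMr ?mulr_gt0 ?(lt_le_trans ltr01)// mul1r.
rewrite -subr_ge0.
have -> : (n%:R + 1) * ((n - k)%:R + 2 * s) - ((n - k)%:R + 1) * (n%:R + 2 * s)
  = (n%:R - (n - k)%:R) * (2 * s - 1) by ring.
by rewrite mulr_ge0 ?subr_ge0.
Qed.

Lemma harm_rate_monoSS n k : (0 < k)%N -> (k <= n)%N ->
  harm_rate s n.+1 k.+1 <= harm_rate s n k.
Proof.
move=> k0 kn; rewrite harm_rateSS// ler_piMr ?(ltW (harm_rate_gt0 k0 kn))//.
rewrite mulr_ile1 //.
- by rewrite divr_ge0// (le_trans ler01).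
- by rewrite ler_pdivrMr ?ltr0n// mul1r ler_nat.
- by rewrite ler_pdivrMr ?(lt_le_trans ltr01)// mul1r lerD2l.
Qed.

End harmonic_rates.

(** The coupling of two systems with interlacing jump rates a_1 >= b_1 >= a_2 >=
    ... >= a_(n+1). Think of x_k and y_k as the gains of the systems when k
    particles jump: a jump of size k in the second system is matched with one of
    size k or k + 1 in the first, and x_1 >= 0 stands for the unmatched jump of
    the additional particle. The rate of the match (k, k + 1) is an alternating
    sum of the a's and b's; the induction avoids computing it by carrying an
    arbitrary amount q <= b_m of the mass of y_m that is left for x_(m+1). *)
Lemma interlaced_sum_ge0 (R : realDomainType) (a b x y : nat -> R) (n : nat) :
  (forall k, (0 < k <= n)%N -> a k.+1 <= b k <= a k) -> 0 <= a n.+1 ->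
  (forall k, (0 < k <= n)%N -> y k <= x k /\ y k <= x k.+1) -> 0 <= x 1%N ->
  \sum_(1 <= k < n.+1) b k * y k <= \sum_(1 <= k < n.+2) a k * x k.
Proof.
move=> ab a0 xy x1.
pose T m := \sum_(1 <= k < m.+1) (a k * x k - b k * y k).
suff inv m (q : R) : (0 < m <= n)%N -> 0 <= q <= b m -> - (q * y m) <= T m.
  rewrite -subr_ge0 big_nat_recr//= addrAC -sumrB -/(T n).
  case: n => [|n] in ab a0 xy inv *.
    by rewrite /T big_geq// add0r mulr_ge0.
  have nn : (0 < n.+1 <= n.+1)%N by rewrite /= leqnn.
  have /andP[abn _] := ab _ nn.
  have := inv n.+1 (a n.+2) nn; rewrite a0 abn => /(_ isT).
  have [_ xyn] := xy _ nn.
  by have := ler_wpM2l a0 xyn; lra.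
elim: m q => [|m ih] q // mn /andP[q0 qb].
have /andP[_ ba] := ab m.+1 mn.
have [xym _] := xy _ mn.
rewrite /T big_nat_recr//= -/(T m).
(* Of the mass b_m of y_m, q is left for x_(m+1) and b_m - q is matched with x_m;
   the rest q' = a_m - (b_m - q) of the mass of x_m is matched with y_(m-1). *)
pose q' := q + (a m.+1 - b m.+1).
have q'0 : 0 <= q' by rewrite /q' addr_ge0// subr_ge0.
have Tm : - (q' * x m.+1) <= T m.
  case: m => [|m] in ih mn q' qb ba xym q'0 *.
    by rewrite /T big_geq// oppr_le0 mulr_ge0.
  have mn' : (0 < m.+1 <= n)%N by rewrite /= ltnW.
  have /andP[abm _] := ab _ mn'.
  apply: (@le_trans _ _ (- (q' * y m.+1))).
    by rewrite lerN2 ler_wpM2l//; have [] := xy _ mn'.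
  by apply: ih => //; rewrite q'0 /q' (le_trans _ abm)// addrCA gerDl subr_le0.
have bq : 0 <= b m.+1 - q by rewrite subr_ge0.
have := ler_wpM2l bq xym; rewrite /q' in Tm; move: Tm; lra.
Qed.

(** * Configurations and their levels *)

Section configurations.
Context (N : nat).
Implicit Types (x y z : 'Z_N) (eta : config N).

Definition total eta : nat := (\sum_x eta x)%N.

Definition add_particle z eta : config N := [ffun x => (eta x + (x == z))%N].

Lemma move_particles0 x y eta : move_particles x y 0 eta = eta.
Proof. by apply/ffunP => t; rewrite ffunE !mul0n subn0 addn0. Qed.

Lemma move_add_particle x y z k eta : (k <= eta x)%N ->
  move_particles x y k (add_particle z eta) =
  add_particle z (move_particles x y k eta).
Proof.
move=> kx; apply/ffunP => t; rewrite !ffunE.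
by have [->|tx] := eqVneq t x; rewrite ?muln1 ?muln0; lia.
Qed.

Lemma moveS_add_particle x y k eta : x != y -> (k <= eta x)%N ->
  move_particles x y k.+1 (add_particle x eta) =
  add_particle y (move_particles x y k eta).
Proof.
move=> xy kx; apply/ffunP => t; rewrite !ffunE.
have [->|tx] := eqVneq t x; first by rewrite (negbTE xy) ?muln1 ?muln0; lia.
by rewrite ?muln1 ?muln0; case: (t == y); lia.
Qed.

Lemma total_move x y k eta : x != y -> (k <= eta x)%N ->
  total (move_particles x y k eta) = total eta.
Proof.
move=> xy kx; rewrite /total (bigD1 x)//= (bigD1 y) 1?eq_sym//=.
rewrite [RHS](bigD1 x)//= [X in (_ = _ + X)%N](bigD1 y) 1?eq_sym//=.
rewrite !ffunE !eqxx (negbTE xy) eq_sym (negbTE xy).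
rewrite (eq_bigr (fun i => eta i)).
  by rewrite muln1 !muln0 subn0 !addn0; set S := (\sum_(i | _) _)%N; lia.
move=> i /andP[ix iy].
by rewrite ffunE (negbTE ix) (negbTE iy) !muln0 subn0 addn0.
Qed.

Lemma total_add_particle z eta : total (add_particle z eta) = (total eta).+1.
Proof.
rewrite /total (eq_bigr (fun x => eta x + (x == z))%N); last first.
  by move=> i _; rewrite ffunE.
rewrite big_split/= [X in (_ + X)%N](bigD1 z)//= eqxx.
rewrite [X in (_ + (_ + X))%N]big1 ?addn0 ?addn1//.
by move=> i /negbTE ->.
Qed.

Lemma le_total eta x : (eta x <= total eta)%N.
Proof. by rewrite /total (bigD1 x)//= leq_addr. Qed.

Lemma level_finite n : exists r : seq (config N),
  uniq r /\ forall eta, (eta \in r) = (total eta == n).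
Proof.
pose emb (g : {ffun 'Z_N -> 'I_n.+1}) : config N := [ffun x => val (g x)].
pose box := enum [set: {ffun 'Z_N -> 'I_n.+1}]%SET.
exists [seq eta <- undup [seq emb g | g <- box] | total eta == n].
split; first by rewrite filter_uniq// undup_uniq.
move=> eta; rewrite mem_filter mem_undup; case: eqP => //= etan.
apply/mapP; exists [ffun x => inord (eta x)]; first by rewrite mem_enum inE.
by apply/ffunP => x; rewrite !ffunE/= inordK// ltnS -etan le_total.
Qed.

End configurations.

(** * Increments under the generator *)

Section harmonic_generator.
Context (R : realType) (N : nat) (s : R).
Implicit Types (x y z : 'Z_N) (eta xi : config N) (f g : config N -> R).

Lemma nabla_harmD x y f g eta :
  nabla_harm s x y (fun e => f e + g e) eta =
  nabla_harm s x y f eta + nabla_harm s x y g eta.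
Proof.
rewrite /nabla_harm -big_split; apply: eq_bigr => k _ /=.
by rewrite -mulrDr; congr (_ * _); rewrite opprD addrACA.
Qed.

Lemma nabla_harmZ x y c f eta :
  nabla_harm s x y (fun e => c * f e) eta = c * nabla_harm s x y f eta.
Proof.
rewrite /nabla_harm mulr_sumr; apply: eq_bigr => k _ /=.
by rewrite mulrCA; congr (_ * _); rewrite mulrBr.
Qed.

Lemma gen_harmD f g eta :
  gen_harm s (fun e => f e + g e) eta = gen_harm s f eta + gen_harm s g eta.
Proof.
rewrite /gen_harm -big_split; apply: eq_bigr => x _ /=.
by rewrite !nabla_harmD addrACA.
Qed.

Lemma gen_harmZ c f eta :
  gen_harm s (fun e => c * f e) eta = c * gen_harm s f eta.
Proof.
rewrite /gen_harm mulr_sumr; apply: eq_bigr => x _ /=.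
by rewrite !nabla_harmZ mulrDr.
Qed.

Definition bond_rate x eta : R :=
  \sum_(1 <= k < (eta x).+1) harm_rate s (eta x) k.

Definition exit_rate eta : R :=
  \sum_x (bond_rate x eta + bond_rate (x + 1) eta).

Lemma next_site_neq x : x != x + 1.
Proof.
rewrite -[X in X != _]addr0; apply/negP => /eqP/addrI/eqP.
rewrite eq_sym => /eqP/(congr1 val) /=.
by rewrite modn_small// Zp_cast.
Qed.

(** Jumps preserve the number of particles, so the generator at eta sees only
    configurations with as many particles as eta. *)
Lemma nabla_harm_level x y f g eta n : x != y -> total eta = n ->
  (forall e, total e = n -> f e = g e) ->
  nabla_harm s x y f eta = nabla_harm s x y g eta.
Proof.
move=> xy en fg; rewrite /nabla_harm; apply: eq_big_nat => k /andP[_ kx].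
by rewrite !fg// total_move.
Qed.

Lemma gen_harm_level f g eta n : total eta = n ->
  (forall e, total e = n -> f e = g e) -> gen_harm s f eta = gen_harm s g eta.
Proof.
move=> en fg; rewrite /gen_harm; apply: eq_bigr => x _.
have nx := next_site_neq x.
congr (_ + _); first exact: nabla_harm_level en fg.
by apply: nabla_harm_level en fg; rewrite eq_sym.
Qed.

Lemma gen_harm0 f eta :
  (forall e, total e = total eta -> f e = 0) -> gen_harm s f eta = 0.
Proof.
move=> f0; rewrite (@gen_harm_level _ (fun e => 0 * f e) _ _ erefl).
  by rewrite gen_harmZ mul0r.
by move=> e /f0 ->; rewrite mulr0.
Qed.

Hypothesis hs : 1 / 2 <= s.

Lemma harm_rate_ge0 n k : (0 < k <= n)%N -> 0 <= harm_rate s n k.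
Proof. by move=> /andP[k0 kn]; exact/ltW/harm_rate_gt0. Qed.

Lemma bond_rate_ge0 x eta : 0 <= bond_rate x eta.
Proof.
rewrite /bond_rate big_nat_cond; apply: sumr_ge0 => k /andP[/andP[k0 kx] _].
by rewrite harm_rate_ge0// k0.
Qed.

Lemma exit_rate_ge0 eta : 0 <= exit_rate eta.
Proof. by apply: sumr_ge0 => x _; rewrite addr_ge0 ?bond_rate_ge0. Qed.

(** After a coupled jump of the pair (eta, eta + delta_z) from x to y, the
    increment of g is again one on the level of eta, hence at least - c; these
    jumps happen at total rate [bond_rate x (eta + delta_z)]. If the additional
    particle is not at x then both systems jump together, otherwise the coupling
    of [interlaced_sum_ge0] is used. *)
Lemma nabla_harm_increment x y z g c eta n : x != y -> total eta = n ->
  (forall z' e, total e = n -> - c <= g (add_particle z' e) - g e) ->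
  - (bond_rate x (add_particle z eta) * (g (add_particle z eta) - g eta + c)) <=
  nabla_harm s x y g (add_particle z eta) - nabla_harm s x y g eta.
Proof.
move=> xy en gc; set xi := add_particle z eta; set w := g xi - g eta.
have mvn k : (k <= eta x)%N -> total (move_particles x y k eta) = n.
  by move=> kx; rewrite total_move.
have [zx|zx] := eqVneq z x; last first.
  have xix : xi x = eta x by rewrite ffunE eq_sym (negbTE zx) addn0.
  rewrite /nabla_harm /bond_rate xix -sumrB mulr_suml -sumrN.
  apply: ler_sum_nat => k /andP[k0 kx].
  rewrite move_add_particle//.
  have := gc z _ (mvn _ kx).
  set u := g (add_particle _ _); set v := g (move_particles _ _ _ _).
  have r0 : 0 <= harm_rate s (eta x) k by rewrite harm_rate_ge0// k0.
  move=> uv; rewrite -mulrBr -mulrN ler_wpM2l// /w; move: uv; lra.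
have xix : xi x = (eta x).+1 by rewrite ffunE zx eqxx addn1.
rewrite /nabla_harm /bond_rate xix.
pose a k := harm_rate s (eta x).+1 k.
pose b k := harm_rate s (eta x) k.
(* the shift by w + c turns the lower bound - c on increments into x >= y *)
pose X k := g (move_particles x y k xi) - g xi + (w + c).
pose Y k := g (move_particles x y k eta) - g eta.
have XY : \sum_(1 <= k < (eta x).+1) b k * Y k <= \sum_(1 <= k < (eta x).+2) a k * X k.
  apply: interlaced_sum_ge0.
  - move=> k /andP[k0 kx]; apply/andP.
    by split; [exact: harm_rate_monoSS|exact: harm_rate_monoS].
  - by rewrite harm_rate_ge0/=.
  - move=> k /andP[k0 kx].
    rewrite /X /Y /xi zx move_add_particle// moveS_add_particle//.
    have := gc x _ (mvn _ kx); have := gc y _ (mvn _ kx).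
    by rewrite /w /xi zx; move=> ? ?; split; lra.
  - rewrite /X /xi zx moveS_add_particle// move_particles0.
    by have := gc y _ en; rewrite /w /xi zx; lra.
have aX : \sum_(1 <= k < (eta x).+2) a k * X k =
    \sum_(1 <= k < (eta x).+2) a k * (g (move_particles x y k xi) - g xi) +
    (\sum_(1 <= k < (eta x).+2) a k) * (w + c).
  by rewrite mulr_suml -big_split; apply: eq_bigr => k _ /=; rewrite /X mulrDr.
by move: XY; rewrite aX /a /b /Y; lra.
Qed.

Lemma gen_harm_increment z g c eta n : total eta = n ->
  (forall z' e, total e = n -> - c <= g (add_particle z' e) - g e) ->
  - (exit_rate (add_particle z eta) * (g (add_particle z eta) - g eta + c)) <=
  gen_harm s g (add_particle z eta) - gen_harm s g eta.
Proof.
move=> en gc; rewrite /gen_harm /exit_rate -sumrB mulr_suml -sumrN.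
apply: ler_sum => x _; have nx := next_site_neq x.
rewrite mulrDl !opprD [leRHS]addrACA; apply: lerD.
  exact: nabla_harm_increment nx en gc.
by rewrite eq_sym in nx; exact: nabla_harm_increment nx en gc.
Qed.

(** With w the increment of g and r the exit rate, the new increment is at least
    w - h r (w + c) = (1 - h r) (w + c) - c. *)
Lemma euler_step_increment z g c eta n (h : R) : 0 <= h ->
  h * exit_rate (add_particle z eta) <= 1 -> total eta = n ->
  (forall z' e, total e = n -> - c <= g (add_particle z' e) - g e) ->
  - c <= (g (add_particle z eta) + h * gen_harm s g (add_particle z eta)) -
         (g eta + h * gen_harm s g eta).
Proof.
move=> h0 hr en gc.
have := ler_wpM2l h0 (gen_harm_increment z en gc).
have := gc z _ en.
set w := g _ - g eta; set L1 := gen_harm _ _ _; set L0 := gen_harm _ _ _.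
set r := exit_rate _ in hr * => cw le1.
have : 0 <= (1 - h * r) * (w + c) by rewrite mulr_ge0 ?subr_ge0//; lra.
move: le1; rewrite /w; lra.
Qed.

End harmonic_generator.

(** * Bounded functions, probability measures and kernels *)

Section bounded_expectation.
Context d (T : measurableType d) (R : realType).
Context (m : {measure set T -> \bar R}) (m1 : m setT = 1%E).
Implicit Types (f g : T -> R).

Lemma bound_bounded_fun f (B : R) : (forall x, `|f x| <= B) -> bounded_fun f.
Proof.
move=> fB; exists B; split; first exact: num_real.
by move=> M BM x _ /=; rewrite (le_trans (fB x))// ltW.
Qed.

Lemma bound_integrable f B : measurable_fun setT f -> (forall x, `|f x| <= B) ->
  m.-integrable setT (EFin \o f).
Proof.
move=> mf fB; apply: measurable_bounded_integrable => //.
  by rewrite m1 ltry.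
exact: bound_bounded_fun fB.
Qed.

Lemma Rintegral_prob_cst (c : R) : \int[m]_x c = c.
Proof. by rewrite Rintegral_cst// m1 mulr1. Qed.

Lemma norm_Rintegral_prob f B : measurable_fun setT f ->
  (forall x, `|f x| <= B) -> `|\int[m]_x f x| <= B.
Proof.
move=> mf fB; have If := bound_integrable mf fB.
have Icst (c : R) : m.-integrable setT (EFin \o cst c).
  by apply: (@bound_integrable _ `|c|) => //; exact: measurable_cst.
rewrite ler_norml -(Rintegral_prob_cst (- B)) -{2}(Rintegral_prob_cst B).
apply/andP; split; apply: le_Rintegral => //; do ?exact: Icst.
- by move=> x _; have := fB x; rewrite ler_norml => /andP[].
- by move=> x _; have := fB x; rewrite ler_norml => /andP[].
Qed.

End bounded_expectation.

Section kernel_composition.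
Context d1 d2 d3 (X : measurableType d1) (Y : measurableType d2)
  (Z : measurableType d3) (R : realType).

(** Composition of kernels lets the second kernel depend on the starting point as
    well; this is the kernel that ignores it. *)
Definition ksnd (k : R.-pker Y ~> Z) (p : X * Y) : {measure set Z -> \bar R} := k p.2.

Variable k : R.-pker Y ~> Z.

Let measurable_ksnd U : measurable U -> measurable_fun [set: X * Y] (ksnd k ^~ U).
Proof.
by move=> mU; apply: (measurableT_comp (measurable_kernel k U mU)); exact: measurable_snd.
Qed.

HB.instance Definition _ := isKernel.Build _ _ _ _ _ (ksnd k) measurable_ksnd.

Let ksnd_prob p : ksnd k p setT = 1%E.
Proof. exact: prob_kernel. Qed.

HB.instance Definition _ := Kernel_isProbability.Build _ _ _ _ _ (ksnd k) ksnd_prob.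

Lemma ge0_integral_kernel_comp (l : R.-pker X ~> Y) (m : {measure set Z -> \bar R}) x :
  (forall A, measurable A -> m A = \int[l x]_y k y A)%E ->
  forall f : Z -> \bar R, (forall z, 0 <= f z)%E -> measurable_fun setT f ->
  (\int[m]_z f z = \int[l x]_y \int[k y]_z f z)%E.
Proof.
move=> mE f f0 mf; rewrite -(integral_kcomp l (ksnd k) x f0 mf).
by apply: eq_measure_integral => A mA _; exact: mE.
Qed.

Lemma Rintegral_kernel_comp (l : R.-pker X ~> Y) (m : {measure set Z -> \bar R}) x :
  (forall A, measurable A -> m A = \int[l x]_y k y A)%E ->
  forall (f : Z -> R) B, (forall z, `|f z| <= B) -> measurable_fun setT f ->
  \int[m]_z f z = \int[l x]_y \int[k y]_z f z.
Proof.
move=> mE f B fB mf.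
have m1 : m setT = 1%E.
  rewrite mE// (eq_integral (cst 1%E)); last by move=> y _; rewrite prob_kernel.
  by rewrite integral_cst// mul1e prob_kernel.
have k1 y : k y setT = 1%E by exact: prob_kernel.
have l1 : l x setT = 1%E by exact: prob_kernel.
(* the nonnegative case is applied to f + B *)
pose g z := f z + B.
have g0 z : 0 <= g z by have := fB z; rewrite ler_norml /g => /andP[? _]; lra.
have gB z : `|g z| <= B + B.
  by rewrite ger0_norm// lerD2r; have := fB z; rewrite ler_norml => /andP[].
have mg : measurable_fun setT g by exact: measurable_funD.
have shift (n : {measure set Z -> \bar R}) : n setT = 1%E ->
    \int[n]_z g z = \int[n]_z f z + B.
  move=> n1; rewrite /g RintegralD ?Rintegral_prob_cst//.
    exact: bound_integrable fB.
  by apply: (@bound_integrable _ _ _ _ n1 _ `|B|) => //; exact: measurable_cst.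
have Eg : (\int[m]_z (g z)%:E = \int[l x]_y \int[k y]_z (g z)%:E)%E.
  apply: ge0_integral_kernel_comp => //; exact/measurable_EFinP.
have kg y : (\int[k y]_z (g z)%:E)%E = (\int[k y]_z f z + B)%:E.
  rewrite -shift// /Rintegral fineK//.
  apply: integrable_fin_num => //; exact: (bound_integrable (k1 y) mg gB).
have mkf : measurable_fun setT (fun y => \int[k y]_z f z).
  have mh : measurable_fun setT (fun y => \int[k y]_z (g z)%:E)%E.
    apply: measurable_fun_integral_kernel => //.
    - by move=> U mU; exact: measurable_kernel.
    - exact/measurable_EFinP.
  have : measurable_fun setT (fun y => (\int[k y]_z f z + B)%:E).
    by apply: eq_measurable_fun mh => y _; rewrite kg.
  move=> /measurable_EFinP mh2.
  rewrite (_ : (fun y => _) = (fun y => (\int[k y]_z f z + B) - B)).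
    exact: measurable_funB.
  by apply/funext => y; rewrite addrK.
have kfB y : `|\int[k y]_z f z| <= B by exact: norm_Rintegral_prob.
apply: (@addIr _ B); rewrite -shift// /Rintegral Eg.
under eq_integral do rewrite kg.
rewrite -[LHS]/(\int[l x]_y (\int[k y]_z f z + B)).
rewrite RintegralD ?Rintegral_prob_cst//.
  exact: bound_integrable kfB.
by apply: (@bound_integrable _ _ _ _ l1 _ `|B|) => //; exact: measurable_cst.
Qed.

End kernel_composition.

(** * The semigroup and its Euler approximation *)

Lemma near_all_seq (I : eqType) (T : Type) (F : set_system T) {FF : Filter F}
    (r : seq I) (P : I -> T -> Prop) :
  (forall i, i \in r -> \forall x \near F, P i x) ->
  \forall x \near F, forall i, i \in r -> P i x.
Proof.
elim: r => [|a r ih] Pr; first by near=> x => i.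
have h1 := Pr a (mem_head _ _).
have h2 : \forall x \near F, forall i, i \in r -> P i x.
  by apply: ih => i ir; apply: Pr; rewrite inE ir orbT.
by near=> x => i; rewrite inE => /predU1P[->|]; [near: x|move: i; near: x].
Unshelve. all: by end_near. Qed.

(** Two ordered configurations are joined by adding one particle at a time. *)
Lemma increments_monotone (R : realType) (N : nat) (g : config N -> R) :
  (forall z eta, g eta <= g (add_particle z eta)) -> monotone_fun g.
Proof.
move=> gz eta xi; have [n] := ubnP (total xi - total eta).
elim: n => // n ih in eta *; rewrite ltnS => dn le.
have [->//|] := eqVneq eta xi; move=> /eqP ne.
have [z zlt] : exists z, (eta z < xi z)%N.
  apply: contrapT => /forallNP h; apply: ne; apply/ffunP => z.
  by apply/eqP; rewrite eqn_leq le leqNgt; apply/negP/h.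
apply: (le_trans (gz z eta)); apply: ih => [|x]; last first.
  by rewrite ffunE; have := le x; case: eqP => [->|]/=; lia.
rewrite total_add_particle.
have : (total eta < total xi)%N.
  rewrite /total (bigD1 z)//= [X in (_ < X)%N](bigD1 z)//=.
  by rewrite -addSn leq_add// leq_sum.
by move: dn; lia.
Qed.

Section harmonic_semigroup.
Context (R : realType) (s : R) (hs : 1 / 2 <= s) (N : nat).
Context (S : R -> R.-pker config N ~> config N).
Hypotheses (HS : markov_semigroup S) (HL : has_generator S (gen_harm (N := N) s)).
Implicit Types (f g : config N -> R) (eta xi : config N) (z : 'Z_N).

Lemma measurable_config (f : config N -> R) : measurable_fun setT f.
Proof. by []. Qed.

Lemma S_setT t eta : S t eta setT = 1%E.
Proof. exact: prob_kernel. Qed.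

Lemma norm_semigroup_fun t f B : (forall e, `|f e| <= B) ->
  forall eta, `|semigroup_fun S t f eta| <= B.
Proof. by move=> fB eta; exact: (norm_Rintegral_prob (S_setT t eta)). Qed.

Lemma semigroup_fun0 f eta : semigroup_fun S 0 f eta = f eta.
Proof.
rewrite /semigroup_fun /Rintegral.
rewrite (eq_measure_integral (dirac eta)); last first.
  by move=> A mA _; exact: (semigroup0 HS).
by rewrite integral_dirac// diracT mul1e.
Qed.

Lemma semigroup_fun_add u v f B : 0 <= u -> 0 <= v -> (forall e, `|f e| <= B) ->
  forall eta, semigroup_fun S (u + v) f eta =
              semigroup_fun S u (semigroup_fun S v f) eta.
Proof.
move=> u0 v0 fB eta; apply: Rintegral_kernel_comp fB _ => // A mA.
exact: (semigroupD HS).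
Qed.

Definition euler_error h f eta : R :=
  semigroup_fun S h f eta - (f eta + h * gen_harm s f eta).

Lemma euler_errorD h f g B C eta :
  (forall e, `|f e| <= B) -> (forall e, `|g e| <= C) ->
  euler_error h (fun e => f e + g e) eta = euler_error h f eta + euler_error h g eta.
Proof.
move=> fB gC; rewrite /euler_error gen_harmD /semigroup_fun RintegralD//.
- by ring.
- exact: (bound_integrable (S_setT _ _)) fB.
- exact: (bound_integrable (S_setT _ _)) gC.
Qed.

Lemma euler_errorZ h c f B eta : (forall e, `|f e| <= B) ->
  euler_error h (fun e => c * f e) eta = c * euler_error h f eta.
Proof.
move=> fB; rewrite /euler_error gen_harmZ /semigroup_fun RintegralZl//.
  by ring.
exact: (bound_integrable (S_setT _ _)) fB.
Qed.

Lemma euler_error_small f B eta (eps : R) : (forall e, `|f e| <= B) -> 0 < eps ->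
  \forall h \near 0^'+, `|euler_error h f eta| <= eps * h.
Proof.
move=> fB eps0.
have /cvgrPdist_le/(_ _ eps0) := @HL f (measurable_config f) (bound_bounded_fun fB) eta.
apply: filterS2 (nbhs_right_gt 0) => h h0.
rewrite -normrN opprB => le; rewrite /euler_error.
set D := semigroup_fun _ _ _ _ - _ in le *.
have -> : semigroup_fun S h f eta - (f eta + h * gen_harm s f eta) =
    h * (h^-1 * D - gen_harm s f eta).
  by rewrite mulrBr mulrA mulfV ?gt_eqF// mul1r /D opprD addrA.
by rewrite normrM gtr0_norm// mulrC ler_wpM2r// ltW.
Qed.

Definition point (eta e : config N) : R := (e == eta)%:R.

Definition off_level n (e : config N) : R := (total e != n)%:R.

Lemma norm_bool_le1 (b : bool) : `|b%:R : R| <= 1.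
Proof. by case: b; rewrite ?normr1 ?normr0. Qed.

Lemma euler_error_seq h f eta (r : seq (config N)) : uniq r ->
  euler_error h (fun e => (e \in r)%:R * f e) eta =
  \sum_(e <- r) f e * euler_error h (point e) eta.
Proof.
elim: r => [_|a r ih /andP[ar ur]].
  rewrite big_nil (_ : (fun e => _) = (fun e => 0 * point eta e)).
    by rewrite (@euler_errorZ _ _ _ 1) ?mul0r// => e; exact: norm_bool_le1.
  by apply/funext => e; rewrite in_nil !mul0r.
rewrite big_cons -ih// -(@euler_errorZ _ _ _ 1); last by move=> e; exact: norm_bool_le1.
rewrite -(@euler_errorD _ _ _ `|f a| (\sum_(e <- r) `|f e|)).
- congr euler_error; apply/funext => e; rewrite inE /point.
  have [->|ea] := eqVneq e a; first by rewrite (negbTE ar) mul0r addr0 mulrC.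
  by rewrite mulr0 add0r.
- by move=> e; rewrite normrM ler_piMr ?norm_bool_le1.
- move=> e; have [er|_] := boolP (e \in r); last by rewrite mul0r normr0 sumr_ge0.
  by rewrite mul1r (big_rem e)//= lerDl sumr_ge0.
Qed.

(** The error is linear in g, and g is the sum over the configurations e of the
    level of g(e) 1_e, plus 1_off g. The finitely many point indicators have small
    errors, with coefficients at most B. On the level the error of 1_off g is
    P_h (1_off g), which is at most B P_h 1_off, that is, B times the error of
    1_off. *)
Lemma euler_error_uniform n B (eps : R) : 0 <= B -> 0 < eps ->
  \forall h \near 0^'+, forall g, (forall e, `|g e| <= B) ->
    forall eta, total eta = n -> `|euler_error h g eta| <= eps * h.
Proof.
move=> B0 eps0; have [r [ur memr]] := level_finite N n.
pose K : R := B * (size r).+1%:R + 1.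
have K0 : 0 < K by rewrite ltr_wpDl// mulr_ge0.
pose d := eps / K.
have d0 : 0 < d by rewrite divr_gt0.
have near1 : \forall h \near 0^'+, forall eta, eta \in r ->
    forall e, e \in r -> `|euler_error h (point e) eta| <= d * h.
  apply: near_all_seq => eta _; apply: near_all_seq => e _.
  by apply: (@euler_error_small _ 1) => // e'; exact: norm_bool_le1.
have near2 : \forall h \near 0^'+, forall eta, eta \in r ->
    `|euler_error h (off_level n) eta| <= d * h.
  apply: near_all_seq => eta _.
  by apply: (@euler_error_small _ 1) => // e'; exact: norm_bool_le1.
have h0 : \forall h \near (0 : R)^'+, 0 < h by exact: nbhs_right_gt.
near=> h => g gB eta etan.
have hgt0 : 0 < h by near: h.
have etar : eta \in r by rewrite memr etan.
have -> : g = (fun e => (e \in r)%:R * g e + off_level n e * g e).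
  apply/funext => e; rewrite -mulrDl /off_level memr.
  by case: eqP; rewrite ?addr0 ?add0r mul1r.
have offB e : `|off_level n e * g e| <= B.
  by rewrite normrM (le_trans _ (gB e))// ler_piMl// norm_bool_le1.
have inB e : `|(e \in r)%:R * g e| <= B.
  by rewrite normrM (le_trans _ (gB e))// ler_piMl// norm_bool_le1.
rewrite (euler_errorD _ _ inB offB) euler_error_seq//.
have bound1 : `|\sum_(e <- r) g e * euler_error h (point e) eta| <=
    (size r)%:R * (B * (d * h)).
  apply: (le_trans (ler_norm_sum _ _ _)).
  have -> : (size r)%:R * (B * (d * h)) = \sum_(e <- r) B * (d * h).
    by rewrite big_const_seq count_predT iter_addr_0 mulr_natl.
  rewrite big_seq [leRHS]big_seq; apply: ler_sum => e er.
  by rewrite normrM ler_pM//; move: e er; move: (eta) etar; near: h.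
(* functions vanishing on the level are also annihilated by the generator there *)
have off0 (u : config N -> R) : (forall e, total e = n -> u e = 0) ->
    euler_error h u eta = semigroup_fun S h u eta.
  move=> u0; rewrite /euler_error u0// gen_harm0 ?mulr0 ?addr0 ?subr0//.
  by rewrite etan.
have bound2 : `|euler_error h (fun e => off_level n e * g e) eta| <= B * (d * h).
  rewrite off0; last by move=> e en; rewrite /off_level en eqxx mul0r.
  apply: (@le_trans _ _ (B * semigroup_fun S h (off_level n) eta)).
    rewrite /semigroup_fun.
    have Ioff : (S h eta).-integrable setT (EFin \o off_level n).
      by apply: (@bound_integrable _ _ _ _ (S_setT _ _) _ 1) => // e; exact: norm_bool_le1.
    rewrite -RintegralZl//.
    have Ig : (S h eta).-integrable setT (EFin \o (fun e => off_level n e * g e)).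
      exact: (bound_integrable (S_setT _ _)) offB.
    apply: (le_trans (le_normr_Rintegral _ Ig)) => //.
    apply: le_Rintegral => //.
    - apply: (@bound_integrable _ _ _ _ (S_setT _ _) _ B) => // e.
      by rewrite normr_id.
    - apply: (@bound_integrable _ _ _ _ (S_setT _ _) _ B) => // e.
      by rewrite normrM (ger0_norm B0) ler_piMr// norm_bool_le1.
    - move=> e _; rewrite normrM ger0_norm// mulrC ler_wpM2r//.
  rewrite ler_wpM2l// (le_trans (ler_norm _))//.
  rewrite -off0; last by move=> e en; rewrite /off_level en eqxx.
  by move: (eta) etar; near: h.
apply: (le_trans (ler_normD _ _)); apply: (le_trans (lerD bound1 bound2)).
rewrite /d [leLHS](_ : _ = (B * (size r).+1%:R / K) * (eps * h)); last first.
  by rewrite -natr1; ring.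
by rewrite ler_piMl ?mulr_ge0 ?(ltW eps0) ?(ltW hgt0)// ler_pdivrMr// mul1r /K lerDl.
Unshelve. all: by end_near. Qed.

Definition increments_ge n c g : Prop :=
  forall z eta, total eta = n -> c <= g (add_particle z eta) - g eta.

(** P_h is the Euler step up to eps/2 h at each end of the increment. *)
Lemma semigroup_step_increment n B (eps : R) : 0 <= B -> 0 < eps ->
  \forall h \near 0^'+, forall g c, (forall e, `|g e| <= B) ->
    increments_ge n (- c) g ->
    increments_ge n (- (c + eps * h)) (semigroup_fun S h g).
Proof.
move=> B0 eps0; have e2 : 0 < eps / 2 by rewrite divr_gt0.
have [r [_ memr]] := level_finite N n.+1.
(* a bound for the exit rates of all eta + delta_z with eta on level n *)
pose rmax : R := \sum_(e <- r) exit_rate s e.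
have rmax0 : 0 <= rmax by apply: sumr_ge0 => e _; exact: exit_rate_ge0.
have h0 : \forall h \near (0 : R)^'+, 0 < h by exact: nbhs_right_gt.
have hr : \forall h \near (0 : R)^'+, h < (rmax + 1)^-1.
  by apply: nbhs_right_lt; rewrite invr_gt0 ltr_wpDl.
have errn := euler_error_uniform n B0 e2.
have errS := euler_error_uniform n.+1 B0 e2.
near=> h => g c gB gc z eta etan.
have hgt0 : 0 < h by near: h.
have hlt : h < (rmax + 1)^-1 by near: h.
have xin : total (add_particle z eta) = n.+1 by rewrite total_add_particle etan.
have hexit : h * exit_rate s (add_particle z eta) <= 1.
  have : exit_rate s (add_particle z eta) <= rmax.
    rewrite /rmax (big_rem (add_particle z eta)) ?memr ?xin//= lerDl.
    by apply: sumr_ge0 => e _; exact: exit_rate_ge0.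
  move=> /(ler_wpM2l (ltW hgt0)) /le_trans; apply.
  have r1 : 0 < rmax + 1 by rewrite ltr_wpDl.
  rewrite (@le_trans _ _ (h * (rmax + 1)))//.
    by rewrite ler_wpM2l ?(ltW hgt0)// lerDl.
  by rewrite -ler_pdivlMr// mul1r ltW.
have step := euler_step_increment hs (ltW hgt0) hexit etan gc.
have b0 : `|euler_error h g eta| <= eps / 2 * h.
  by move: (eta) etan; move: (g) gB; near: h.
have b1 : `|euler_error h g (add_particle z eta)| <= eps / 2 * h.
  by move: (add_particle z eta) xin; move: (g) gB; near: h.
move: b0 b1; rewrite !ler_norml /euler_error => /andP[_ b0] /andP[b1 _].
move: b0 b1 step; lra.
Unshelve. all: by end_near. Qed.

Lemma semigroup_iter_increment n B c (h : R) f : 0 <= h ->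
  (forall e, `|f e| <= B) ->
  (forall g c', (forall e, `|g e| <= B) ->
    increments_ge n (- c') g ->
    increments_ge n (- (c' + c)) (semigroup_fun S h g)) ->
  increments_ge n 0 f ->
  forall j, increments_ge n (- (j%:R * c)) (semigroup_fun S (j%:R * h) f).
Proof.
move=> h0 fB step f0; elim=> [|j ih].
  by rewrite !mul0r oppr0 => z eta en; rewrite !semigroup_fun0; exact: f0.
have jh : 0 <= j%:R * h by rewrite mulr_ge0.
have := step _ _ (norm_semigroup_fun _ fB) ih.
have -> : j.+1%:R * h = h + j%:R * h by rewrite -natr1 mulrDl mul1r addrC.
have -> : j.+1%:R * c = j%:R * c + c by rewrite -natr1 mulrDl mul1r.
rewrite (_ : semigroup_fun S (h + _) f =
             semigroup_fun S h (semigroup_fun S (j%:R * h) f))//.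
by apply/funext; exact: semigroup_fun_add fB.
Qed.

(** Take j steps of length h = t / j, short enough for the error eps / t per unit
    of time. *)
Lemma semigroup_increment_ge0 n t f B : 0 <= t -> (forall e, `|f e| <= B) ->
  increments_ge n 0 f -> increments_ge n 0 (semigroup_fun S t f).
Proof.
rewrite le_eqVlt => /predU1P[<- _ f0 z eta en|t0 fB f0 z eta en].
  by rewrite !semigroup_fun0; exact: f0.
have B0 : 0 <= B by rewrite (le_trans _ (fB eta)).
rewrite -oppr_le0; apply/ler_addgt0Pr => eps eps0; rewrite add0r lerNl.
have /(semigroup_step_increment n B0)[d /= d0 step] : 0 < eps / t by rewrite divr_gt0.
pose j := (Num.truncn (t / d)).+1.
have j0 : 0 < j%:R :> R by rewrite ltr0n.
pose h := t / j%:R.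
have h0 : 0 < h by rewrite divr_gt0.
have hd : h < d.
  rewrite ltr_pdivrMr// mulrC -ltr_pdivrMr//.
  exact: truncnS_gt.
have stepj := step h.
have := semigroup_iter_increment (ltW h0) fB _ f0 (c := eps / t * h).
have jh : j%:R * h = t by rewrite /h mulrC divfK// gt_eqF.
have je : j%:R * (eps / t * h) = eps by rewrite mulrCA jh divfK// gt_eqF.
move=> /(_ _ j z eta en); rewrite jh je; apply.
by apply: stepj; rewrite //= sub0r normrN gtr0_norm.
Qed.

Lemma semigroup_monotone t f B : 0 <= t -> (forall e, `|f e| <= B) ->
  monotone_fun f -> monotone_fun (semigroup_fun S t f).
Proof.
move=> t0 fB mf; apply: increments_monotone => z eta.
rewrite -subr_ge0; apply: (semigroup_increment_ge0 t0 fB) (erefl (total eta)).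
move=> z' e _; rewrite subr_ge0; apply: mf => x.
by rewrite ffunE leq_addr.
Qed.

End harmonic_semigroup.

Theorem theorem3p5 (R : realType) (s : R) (hs : 1 / 2 <= s)
    (N : nat) (hN : (2 <= N)%N)
    (S : R -> probability_kernel (config N) (config N) R)
    (HS : markov_semigroup S)
    (HL : has_generator S (gen_harm (N := N) s)) :
  attractive S.
Proof.
move=> mu1 mu2 mu12 t t0 f [B0 [_ fB0]] mf.
pose B := `|B0| + 1.
have fB e : `|f e| <= B.
  by apply: (fB0 B) => //; rewrite /B (le_lt_trans (ler_norm _))// ltrDl.
have EE (mu : probability (config N) R) (g : config N -> R) :
    (forall e, `|g e| <= B) -> ('E_mu[g] = (\int[mu]_e g e)%:E)%E.
  move=> gB; rewrite unlock /Rintegral fineK//; apply: integrable_fin_num => //.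
  exact: (bound_integrable (probability_setT mu)) gB.
have SfB e : `|semigroup_fun S t f e| <= B by exact: norm_semigroup_fun.
have expE (mu : probability (config N) R) :
    ('E_(push_kernel (S t) mu)[f] = 'E_mu[semigroup_fun S t f])%E.
  (* mu as a kernel from the one-point space *)
  have mc : measurable_fun [set: unit] (fun _ : unit => (mu : pprobability _ R)).
    exact: measurable_cst.
  rewrite !EE//; congr EFin.
  exact: (Rintegral_kernel_comp (l := kprobability mc) (k := S t) (x := tt)
    (m := push_kernel (S t) mu) (fun _ _ => erefl) fB (measurable_config f)).
rewrite (expE mu1) (expE mu2).
apply: mu12; first exact: bound_bounded_fun SfB.
exact: (semigroup_monotone hs HS HL t0 fB mf).
Qed.
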